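(* Let $n\ge 4$, let $P$ be an $n\times n$ pentadiagonal matrix over $K$ ($K=\mathbb{R}$ or $\mathbb{C}$) with entries $P_{i,i}=d_i$, $P_{i,i+1}=a_i$, $P_{i,i+2}=b_i$, $P_{i,i-1}=c_i$, $P_{i,i-2}=e_i$ and all other entries $0$, and let $Y=(y_1,\dots,y_n)^t\in K^n$. If $\det(P)\neq 0$, then the symbolic algorithm SPTRANS-I (described in the context) never fails on $(P,Y)$: all its divisions are defined in $K(p)$, the rational functions $x_1(p),\dots,x_n(p)\in K(p)$ it computes can be evaluated at $p=0$ (they have no pole there), and $X=(x_1(0),\dots,x_n(0))^t$ is the solution of $PX=Y$.
   Context: $K(p)$ is the field of rational functions in one indeterminate $p$ (a symbolic name whose actual value is $0$). The algorithm SPTRANS-I, on input $n\ge4$, the entries of $P$ with $\det(P)\ne0$, and $Y$, performs the following computations in $K(p)$ (tests ''$=0$'' mean equality to $0$ in $K(p)$). (1) Set $\mu_1=d_1$; if $\mu_1=0$, replace $\mu_1$ by $p$. Set $\alpha_1=\frac{a_1}{\mu_1}$, $\beta_1=\frac{b_1}{\mu_1}$, $z_1=\frac{y_1}{\mu_1}$, $\gamma_2=c_2$. (2) Set $\mu_2=d_2-\alpha_1\gamma_2$; if $\mu_2=0$, replace $\mu_2$ by $p$. Set $\alpha_2=\frac{a_2-\beta_1\gamma_2}{\mu_2}$, $\beta_2=\frac{b_2}{\mu_2}$, $z_2=\frac{y_2-z_1\gamma_2}{\mu_2}$. (3) For $i=3,\dots,n-2$ in increasing order: $\gamma_i=c_i-\alpha_{i-2}e_i$;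 $\mu_i=d_i-\beta_{i-2}e_i-\alpha_{i-1}\gamma_i$, and if $\mu_i=0$, replace $\mu_i$ by $p$; $\alpha_i=\frac{a_i-\beta_{i-1}\gamma_i}{\mu_i}$; $\beta_i=\frac{b_i}{\mu_i}$; $z_i=\frac{y_i-z_{i-2}e_i-z_{i-1}\gamma_i}{\mu_i}$. (4) $\gamma_{n-1}=c_{n-1}-\alpha_{n-3}e_{n-1}$; $\mu_{n-1}=d_{n-1}-\beta_{n-3}e_{n-1}-\alpha_{n-2}\gamma_{n-1}$, and if $\mu_{n-1}=0$, replace it by $p$; $\alpha_{n-1}=\frac{a_{n-1}-\beta_{n-2}\gamma_{n-1}}{\mu_{n-1}}$; $\gamma_n=c_n-\alpha_{n-2}e_n$; $\mu_n=d_n-\beta_{n-2}e_n-\alpha_{n-1}\gamma_n$, and if $\mu_n=0$, replace it by $p$; $z_{n-1}=\frac{y_{n-1}-z_{n-3}e_{n-1}-z_{n-2}\gamma_{n-1}}{\mu_{n-1}}$; $z_n=\frac{y_n-z_{n-2}e_n-z_{n-1}\gamma_n}{\mu_n}$. (5) $x_n=z_n$, $x_{n-1}=z_{n-1}-\alpha_{n-1}x_n$, and for $i=n-2,\dots,1$: $x_i=z_i-\alpha_ix_{i+1}-\beta_ix_{i+2}$. (6) Substitute $p=0$ in the (simplified) rational functions $x_i=x_i(p)$, $i=1,\dots,n$, and output the result. *)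

(* Defs.v *)
(* MathComp, with a realType R for the reals and R[i] for the complex numbers. *)
From mathcomp Require Import all_boot all_order all_algebra.
From mathcomp Require Import complex.
From mathcomp Require Import reals.

Set Implicit Arguments.
Unset Strict Implicit.
Unset Printing Implicit Defensive.

Import GRing.Theory.
Local Open Scope ring_scope.

Notation ratfun K := {fraction {poly K}}.

Section RatFun.
Variable K : fieldType.

Definition rfconst (c : K) : ratfun K := FracField.tofrac (c%:P).
Definition rfindet : ratfun K := FracField.tofrac 'X.

(* Numerator and denominator in lowest terms (up to a common nonzero scalar). *)
Definition rfnum (f : ratfun K) : {poly K} :=
  let r := repr f in \n_r %/ gcdp \n_r \d_r.
Definition rfden (f : ratfun K) : {poly K} :=
  let r := repr f in \d_r %/ gcdp \n_r \d_r.

Definition has_pole (f : ratfun K) (t : K) : bool := root (rfden f) t.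

(* Only meaningful when f has no pole at t. *)
Definition rfeval (t : K) (f : ratfun K) : K := (rfnum f).[t] / (rfden f).[t].

End RatFun.

(* The sequences are indexed from 1, whereas matrix rows and columns are
   indexed from 0: the entry (i, j) below is P_{i+1,j+1}. *)
Definition pentadiag_mx (K : fieldType) (n : nat) (a b c d e : nat -> K)
    : 'M[K]_n :=
  \matrix_(i < n, j < n)
    if j == i :> nat then d i.+1
    else if j == i.+1 :> nat then a i.+1
    else if j == i.+2 :> nat then b i.+1
    else if i == j.+1 :> nat then c i.+1
    else if i == j.+2 :> nat then e i.+1
    else 0.

Section Sptrans.
Variable K : fieldType.
Notation F := (ratfun K).

(* None stands for the failure caused by a division by zero. *)
Definition pdiv (u v : F) : option F := if v == 0 then None else Some (u / v).

Local Notation "'let!' v ':=' m 'in' k" := (obind (fun v => k) m)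
  (at level 200, v name, m at level 100, k at level 200,
   format "'[v' 'let!'  v  ':='  m  'in' '/' k ']'").

Definition pivot (m : F) : F := if m == 0 then rfindet K else m.

(* Arrays: cell i holds the variable of index i. *)
Record store := Store {
  alpha_ : nat -> F; beta_ : nat -> F; z_ : nat -> F; x_ : nat -> F }.

Definition init_store : store :=
  Store (fun=> 0) (fun=> 0) (fun=> 0) (fun=> 0).

Definition set_alpha (i : nat) (v : F) (s : store) : store :=
  Store [eta alpha_ s with i |-> v] (beta_ s) (z_ s) (x_ s).
Definition set_beta (i : nat) (v : F) (s : store) : store :=
  Store (alpha_ s) [eta beta_ s with i |-> v] (z_ s) (x_ s).
Definition set_z (i : nat) (v : F) (s : store) : store :=
  Store (alpha_ s) (beta_ s) [eta z_ s with i |-> v] (x_ s).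
Definition set_x (i : nat) (v : F) (s : store) : store :=
  Store (alpha_ s) (beta_ s) (z_ s) [eta x_ s with i |-> v].

Variables (n : nat) (a b c d e y : nat -> F).

Definition step1 (s : store) : option store :=
  let mu1 := pivot (d 1) in
  let! alpha1 := pdiv (a 1) mu1 in
  let! beta1 := pdiv (b 1) mu1 in
  let! z1 := pdiv (y 1) mu1 in
  Some (set_alpha 1 alpha1 (set_beta 1 beta1 (set_z 1 z1 s))).

Definition step2 (s : store) : option store :=
  let gamma2 := c 2 in
  let mu2 := pivot (d 2 - alpha_ s 1 * gamma2) in
  let! alpha2 := pdiv (a 2 - beta_ s 1 * gamma2) mu2 in
  let! beta2 := pdiv (b 2) mu2 in
  let! z2 := pdiv (y 2 - z_ s 1 * gamma2) mu2 in
  Some (set_alpha 2 alpha2 (set_beta 2 beta2 (set_z 2 z2 s))).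

Definition step3_body (s : store) (i : nat) : option store :=
  let gammai := c i - alpha_ s (i - 2) * e i in
  let mui := pivot (d i - beta_ s (i - 2) * e i - alpha_ s (i - 1) * gammai) in
  let! alphai := pdiv (a i - beta_ s (i - 1) * gammai) mui in
  let! betai := pdiv (b i) mui in
  let! zi := pdiv (y i - z_ s (i - 2) * e i - z_ s (i - 1) * gammai) mui in
  Some (set_alpha i alphai (set_beta i betai (set_z i zi s))).

(* iota 3 (n - 4) is 3, ..., n - 2 *)
Definition step3 (s : store) : option store :=
  foldl (fun os i => let! s' := os in step3_body s' i) (Some s)
    (iota 3 (n - 4)).

Definition step4 (s : store) : option store :=
  let gamman1 := c (n - 1) - alpha_ s (n - 3) * e (n - 1) in
  let mun1 := pivot (d (n - 1) - beta_ s (n - 3) * e (n - 1)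
                     - alpha_ s (n - 2) * gamman1) in
  let! alphan1 := pdiv (a (n - 1) - beta_ s (n - 2) * gamman1) mun1 in
  let gamman := c n - alpha_ s (n - 2) * e n in
  let mun := pivot (d n - beta_ s (n - 2) * e n - alphan1 * gamman) in
  let! zn1 := pdiv (y (n - 1) - z_ s (n - 3) * e (n - 1)
                    - z_ s (n - 2) * gamman1) mun1 in
  let! zn := pdiv (y n - z_ s (n - 2) * e n - zn1 * gamman) mun in
  Some (set_alpha (n - 1) alphan1 (set_z (n - 1) zn1 (set_z n zn s))).

Definition step5_body (s : store) (i : nat) : store :=
  set_x i (z_ s i - alpha_ s i * x_ s (i + 1) - beta_ s i * x_ s (i + 2)) s.

Definition step5 (s : store) : store :=
  let s1 := set_x n (z_ s n) s in
  let s2 := set_x (n - 1) (z_ s1 (n - 1) - alpha_ s1 (n - 1) * x_ s1 n) s1 in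
  foldl step5_body s2 (rev (iota 1 (n - 2))).

(* The column (x_1(p), ..., x_n(p))^t, before the substitution p = 0. *)
Definition sptrans_ratfun : option 'cV[F]_n :=
  let! s1 := step1 init_store in
  let! s2 := step2 s1 in
  let! s3 := step3 s2 in
  let! s4 := step4 s3 in
  Some (\col_(i < n) x_ (step5 s4) i.+1).

End Sptrans.

(* SPTRANS-I up to its final substitution p = 0, on data in K seen as constants
   of K(p). *)
Definition sptransI (K : fieldType) (n : nat) (a b c d e y : nat -> K)
    : option 'cV[ratfun K]_n :=
  sptrans_ratfun n (@rfconst K \o a) (@rfconst K \o b) (@rfconst K \o c)
    (@rfconst K \o d) (@rfconst K \o e) (@rfconst K \o y).

(* Main.v *)
Require Import Defs.
From mathcomp Require Import all_boot all_order all_algebra.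
From mathcomp Require Import complex.
From mathcomp Require Import reals.
From mathcomp Require Import ring zify.
Import GRing.Theory.
Local Open Scope ring_scope.

(** Replacing a vanishing pivot [mu_i] by [p] is the same as adding [p] to [d_i].
    Hence the algorithm is the LU method, with nonzero pivots, for
    [Q(p) = P + p D], where [D] is a diagonal 0/1 matrix, and the computed column
    satisfies [Q(p) x(p) = Y] over [K(p)]. Multiplying by the adjugate gives
    [det Q(p) x(p) = adj Q(p) Y] with polynomial coefficients, and
    [det Q(0) = det P != 0]: thus [x(p)] has no pole at [0], and its value there is
    given by Cramer's rule for [P]. *)

(** * Regularity and values of rational functions at a point *)

Lemma mul_tofrac_den (A : idomainType) (f : {fraction A}) :
  f * FracField.tofrac \d_(repr f) = FracField.tofrac \n_(repr f).
Proof.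
rewrite -{1}[f]reprK; unlock FracField.tofrac; rewrite -[LHS]FracField.pi_mul.
apply/eqmodP; rewrite /= FracField.equivfE /FracField.mulf.
by rewrite !numden_Ratio ?mulf_neq0 ?oner_neq0 ?denom_ratioP // !mulr1 mulrC.
Qed.

(** Cross-multiplying gives [q * N = r * D], with [N] and [D] the reduced numerator and denominator
    of [f]. If [D] vanished at [t], so would [N], because [q.[t] != 0]; this contradicts
    coprimality. *)
Lemma rfeval_quotient {K : fieldType} {t : K} {f : ratfun K} {q r : {poly K}} :
  q.[t] != 0 -> FracField.tofrac q * f = FracField.tofrac r ->
  ~~ has_pole f t /\ q.[t] * rfeval t f = r.[t].
Proof.
move=> qt0 def_f; rewrite /has_pole /rfeval /rfden /rfnum.
set u := \n_(repr f); set v := \d_(repr f).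
have v0 : v != 0 by exact: denom_ratioP.
have fE : f * FracField.tofrac v = FracField.tofrac u by exact: mul_tofrac_den.
set g := gcdp u v.
have g0 : g != 0 by rewrite gcdp_eq0 negb_and v0 orbT.
have uE : u = u %/ g * g by rewrite divpK ?dvdp_gcdl.
have vE : v = v %/ g * g by rewrite divpK ?dvdp_gcdr.
have cop : coprimep (u %/ g) (v %/ g) by rewrite coprimep_div_gcd // v0 orbT.
have cross : q * (u %/ g) = r * (v %/ g).
  apply: (mulIf g0); rewrite -!mulrA -uE -vE; apply/eqP.
  by rewrite -tofrac_eq !rmorphM /= -fE mulrA def_f.
have crosst : q.[t] * (u %/ g).[t] = r.[t] * (v %/ g).[t].
  by rewrite -!hornerM cross.
have vt0 : (v %/ g).[t] != 0.
  apply/negP => vt; move: crosst; rewrite (eqP vt) mulr0 => /eqP.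
  rewrite mulf_eq0 (negPf qt0) /= => ut.
  by have := coprimep_root cop ut; rewrite vt.
by split => //; rewrite mulrA crosst mulfK.
Qed.

(** * Rows of a pentadiagonal matrix *)

Lemma sum_indicator {F : fieldType} {n : nat} (k : nat) (v : F) {X : nat -> F} :
  (forall j, (n < j)%N -> X j = 0) ->
  \sum_(j < n) (if j == k :> nat then v else 0) * X j.+1 = v * X k.+1.
Proof.
move=> Xn; case: (ltnP k n) => [kn|nk].
  rewrite (bigD1 (Ordinal kn)) //= eqxx big1 ?addr0 // => j.
  by rewrite -val_eqE /= => /negPf ->; rewrite mul0r.
rewrite (Xn k.+1) // mulr0 big1 // => j _.
by rewrite ifN ?mul0r // neq_ltn (leq_trans (ltn_ord j) nk).
Qed.

(** Each diagonal contributes one term. Extending the vector by 0 outside [1..n] lets the truncated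
    border rows obey the same five-term formula. *)
Lemma mul_pentadiag_row {F : fieldType} {n : nat} (a b c d e X : nat -> F) (i : 'I_n) :
  X 0 = 0 -> (forall j, (n < j)%N -> X j = 0) ->
  \sum_(j < n) pentadiag_mx n a b c d e i j * X j.+1 =
  e i.+1 * X i.-1 + c i.+1 * X i + d i.+1 * X i.+1 + a i.+1 * X i.+2
    + b i.+1 * X i.+3.
Proof.
move=> X0 Xn.
(* This is the subdiagonal of offset [k + 1]. When [k = i] no column qualifies, and the right-hand
   side is 0 through [X 0]. *)
have lower v k : (k <= i)%N ->
    \sum_(j < n) (if i == (j + k.+1)%N :> nat then v else 0) * X j.+1
      = v * X (i - k)%N.
  move=> ki; case: (ltnP k i) => [lt_ki|le_ik].
    rewrite (_ : (i - k = (i - k.+1).+1)%N); last lia.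
    rewrite -(@sum_indicator F n _ _ X) //; apply: eq_bigr => j _.
    by have -> : (nat_of_ord i == j + k.+1)%N = (nat_of_ord j == i - k.+1)%N by lia.
  rewrite (_ : (i - k = 0)%N) ?X0 ?mulr0; last lia.
  by rewrite big1 // => j _; rewrite ifN ?mul0r //; lia.
have lower2 : \sum_(j < n) (if i == j.+2 :> nat then e i.+1 else 0) * X j.+1
    = e i.+1 * X i.-1.
  case: (posnP i) => [i0|i_gt0].
    by rewrite i0 X0 mulr0 big1 // => j _; rewrite mul0r.
  rewrite -subn1 -lower //.
  by apply: eq_bigr => j _; rewrite addn2.
have lower1 : \sum_(j < n) (if i == j.+1 :> nat then c i.+1 else 0) * X j.+1
    = c i.+1 * X i.
  have := lower (c i.+1) 0%N (leq0n i); rewrite subn0 => <-.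
  by apply: eq_bigr => j _; rewrite addn1.
rewrite -lower2 -lower1 -!(@sum_indicator F n _ _ X) // -!big_split /=.
apply: eq_bigr => j _; rewrite mxE -!mulrDl; congr (_ * _).
(* The five index conditions exclude each other, so the nested conditional is the sum of the five
   indicators. *)
by do !case: (@eqP nat) => ?; try (exfalso; lia); rewrite ?add0r ?addr0.
Qed.

(** * Pivots after the symbolic replacement *)

Lemma rfindet_neq0 (K : fieldType) : rfindet K != 0.
Proof. by rewrite /rfindet tofrac_eq0 polyX_eq0. Qed.

Lemma pivot_neq0 {K : fieldType} (m : ratfun K) : pivot m != 0.
Proof. by rewrite /pivot; case: ifP => [_|->//]; apply: rfindet_neq0. Qed.

Lemma pivotE {K : fieldType} (m : ratfun K) : pivot m = m + rfindet K *+ (m == 0).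
Proof. by rewrite /pivot; case: eqP => [->|_]; rewrite ?add0r ?addr0. Qed.

(** Every division of the algorithm is by a pivot, so this one rewriting rule removes all possible
    failures. *)
Lemma obind_pdiv_pivot {K : fieldType} {T : Type} (f : ratfun K -> option T)
    (u m : ratfun K) :
  obind f (Defs.pdiv u (pivot m)) = f (u / pivot m).
Proof. by rewrite /Defs.pdiv (negPf (pivot_neq0 m)). Qed.

(** * Forward elimination *)

Section Elimination.
Context {K : fieldType} {a b c d e y : nat -> ratfun K}.
Local Notation F := (ratfun K).

(** The store keeps neither [gamma_i] nor [mu_i]: both are recomputed from it, [mu_i] as it stands
    before the test against 0. *)
Definition gamma_of (s : store K) i : F := c i - alpha_ s (i - 2) * e i.
Definition raw_pivot (s : store K) i : F :=
  d i - beta_ s (i - 2) * e i - alpha_ s (i - 1) * gamma_of s i.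

(* The cells of index 0 are never written: keeping them equal to 0 makes the
   general recurrence also cover rows 1 and 2, where [i - 1] or [i - 2] is [0].
   Three bounds are needed because step (4) leaves [beta_(n-1)], [alpha_n] and
   [beta_n] unset. *)
Record eliminated (ka kb kz : nat) (s : store K) : Prop := Eliminated {
  elim_alpha0 : alpha_ s 0 = 0;
  elim_beta0 : beta_ s 0 = 0;
  elim_z0 : z_ s 0 = 0;
  elim_alpha : forall i, (0 < i <= ka)%N ->
    alpha_ s i = (a i - beta_ s (i - 1) * gamma_of s i) / pivot (raw_pivot s i);
  elim_beta : forall i, (0 < i <= kb)%N -> beta_ s i = b i / pivot (raw_pivot s i);
  elim_z : forall i, (0 < i <= kz)%N ->
    z_ s i = (y i - z_ s (i - 2) * e i - z_ s (i - 1) * gamma_of s i)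
               / pivot (raw_pivot s i) }.

Lemma eliminated_init : eliminated 0 0 0 (init_store K).
Proof. by split=> // i; lia. Qed.

Lemma raw_pivot_local (s s' : store K) i :
  alpha_ s' (i - 2) = alpha_ s (i - 2) -> alpha_ s' (i - 1) = alpha_ s (i - 1) ->
  beta_ s' (i - 2) = beta_ s (i - 2) ->
  gamma_of s' i = gamma_of s i /\ raw_pivot s' i = raw_pivot s i.
Proof. by rewrite /raw_pivot /gamma_of => -> -> ->. Qed.

(** The right-hand side of the equation of index [i > 0] reads only cells of index below [i].
    Writing the cells of index [k.+1] therefore disturbs no earlier equation. *)
Lemma eliminated_set k A B Z s : eliminated k k k s ->
  A = (a k.+1 - beta_ s (k.+1 - 1) * gamma_of s k.+1) / pivot (raw_pivot s k.+1) ->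
  B = b k.+1 / pivot (raw_pivot s k.+1) ->
  Z = (y k.+1 - z_ s (k.+1 - 2) * e k.+1 - z_ s (k.+1 - 1) * gamma_of s k.+1)
        / pivot (raw_pivot s k.+1) ->
  eliminated k.+1 k.+1 k.+1
    (set_alpha k.+1 A (set_beta k.+1 B (set_z k.+1 Z s))).
Proof.
set s' := set_alpha _ _ _.
have alphaE i : alpha_ s' i = if i == k.+1 then A else alpha_ s i by [].
have betaE i : beta_ s' i = if i == k.+1 then B else beta_ s i by [].
have zE i : z_ s' i = if i == k.+1 then Z else z_ s i by [].
(* From here on the new store is opaque, known only through its lookup equations. *)
move: s' alphaE betaE zE => s' alphaE betaE zE [A0 B0 Z0 Ak Bk Zk] AE BE ZE.
have old i : (i < k.+1)%N ->
    [/\ alpha_ s' i = alpha_ s i, beta_ s' i = beta_ s i & z_ s' i = z_ s i].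
  by move=> ik; rewrite alphaE betaE zE (ltn_eqF ik).
have pivots i : (0 < i <= k.+1)%N ->
    gamma_of s' i = gamma_of s i /\ raw_pivot s' i = raw_pivot s i.
  move=> ik; have [|a1 _ _] := old (i - 1)%N; first lia.
  have [|a2 b2 _] := old (i - 2)%N; first lia.
  exact: raw_pivot_local.
split; first by have [->] := old 0%N isT.
- by have [_ ->] := old 0%N isT.
- by have [_ _ ->] := old 0%N isT.
- move=> i ik; have [-> ->] := pivots i ik; have [|_ -> _] := old (i - 1)%N; first lia.
  by rewrite alphaE; case: eqP => [->|ne] //; apply: Ak; lia.
- move=> i ik; have [_ ->] := pivots i ik.
  by rewrite betaE; case: eqP => [->|ne] //; apply: Bk; lia.
- move=> i ik; have [-> ->] := pivots i ik; have [|_ _ ->] := old (i - 1)%N; first lia.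
  have [|_ _ ->] := old (i - 2)%N; first lia.
  by rewrite zE; case: eqP => [->|ne] //; apply: Zk; lia.
Qed.

Lemma eliminated_step3_body {k s} : eliminated k k k s ->
  exists2 s', step3_body a b c d e y s k.+1 = Some s' & eliminated k.+1 k.+1 k.+1 s'.
Proof.
move=> s_elim; rewrite /step3_body !obind_pdiv_pivot.
by eexists; [reflexivity | exact: eliminated_set].
Qed.

(** The zero cells of index 0 cancel every term in which [c 1] or [e 1] occurs. *)
Lemma step1_step3_body {s} : eliminated 0 0 0 s ->
  step1 a b d y s = step3_body a b c d e y s 1.
Proof.
case=> A0 B0 Z0 _ _ _; rewrite /step1 /step3_body /= A0 B0 Z0.
by rewrite !mul0r !subr0.
Qed.

Lemma step2_step3_body {s} : eliminated 1 1 1 s ->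
  step2 a b c d y s = step3_body a b c d e y s 2.
Proof.
case=> A0 B0 Z0 _ _ _; rewrite /step2 /step3_body /= A0 B0 Z0.
by rewrite !mul0r !subr0.
Qed.

Lemma eliminated_step3 {n s} : eliminated 2 2 2 s -> (4 <= n)%N ->
  exists2 s', step3 n a b c d e y s = Some s' & eliminated (n - 2) (n - 2) (n - 2) s'.
Proof.
move=> s_elim hn; rewrite /step3 (_ : n - 2 = 2 + (n - 4))%N; last lia.
elim: (n - 4)%N => [|m [s' IH s'_elim]]; first by exists s.
rewrite -[m.+1]addn1 iotaD foldl_cat IH /= addnA addn1.
by rewrite -add3n addSn; exact: eliminated_step3_body.
Qed.

(** Here [k] stands for [n - 2]. Step (4) uses the new [alpha] and [z] of index [n - 1] before
    storing them, so the last pivot is spelled out with [A] instead of [raw_pivot s k.+2]. *)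
Lemma eliminated_set_last k A Z Zn s : eliminated k k k s ->
  A = (a k.+1 - beta_ s k * gamma_of s k.+1) / pivot (raw_pivot s k.+1) ->
  Z = (y k.+1 - z_ s (k - 1) * e k.+1 - z_ s k * gamma_of s k.+1)
        / pivot (raw_pivot s k.+1) ->
  Zn = (y k.+2 - z_ s k * e k.+2 - Z * gamma_of s k.+2)
        / pivot (d k.+2 - beta_ s k * e k.+2 - A * gamma_of s k.+2) ->
  eliminated k.+1 k k.+2 (set_alpha k.+1 A (set_z k.+1 Z (set_z k.+2 Zn s))).
Proof.
set s' := set_alpha _ _ _.
have alphaE i : alpha_ s' i = if i == k.+1 then A else alpha_ s i by [].
have betaE i : beta_ s' i = beta_ s i by [].
have zE i : z_ s' i = if i == k.+1 then Z else if i == k.+2 then Zn else z_ s i by [].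
move: s' alphaE betaE zE => s' alphaE betaE zE [A0 B0 Z0 Ak Bk Zk] AE ZE ZnE.
have old i : (i < k.+1)%N -> alpha_ s' i = alpha_ s i /\ z_ s' i = z_ s i.
  by move=> ik; rewrite alphaE zE (ltn_eqF ik) (ltn_eqF (leqW ik)).
have pivots i : (0 < i <= k.+1)%N ->
    gamma_of s' i = gamma_of s i /\ raw_pivot s' i = raw_pivot s i.
  move=> ik; have [|a1 _] := old (i - 1)%N; first lia.
  have [|a2 _] := old (i - 2)%N; first lia.
  exact: raw_pivot_local.
split; first by have [->] := old 0%N isT.
- by rewrite betaE.
- by have [_ ->] := old 0%N isT.
- move=> i ik; have [-> ->] := pivots i ik; rewrite betaE alphaE.
  by case: eqP => [->|ne]; [rewrite subn1 | apply: Ak; lia].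
- move=> i ik; have [|_ ->] := pivots i; first lia.
  by rewrite betaE; apply: Bk; lia.
(* Only the last row reads freshly written cells, namely [A] and [Z] at index [k.+1]. *)
- move=> i ik; case: (i =P k.+2) => [->|ne].
    have zk1 : z_ s' k.+1 = Z by rewrite zE eqxx.
    have ak1 : alpha_ s' k.+1 = A by rewrite alphaE eqxx.
    have [ak zk] := old k (ltnSn k).
    have gk : gamma_of s' k.+2 = gamma_of s k.+2.
      by rewrite /gamma_of !subSS subn0 ak.
    rewrite /raw_pivot gk !subSS !subn0 zk1 ak1 zk betaE -ZnE zE.
    by rewrite eqxx gtn_eqF.
  have [|-> ->] := pivots i; first lia.
  have [|_ ->] := old (i - 1)%N; first lia.
  have [|_ ->] := old (i - 2)%N; first lia.
  rewrite zE; case: eqP => [->|ne1]; first by rewrite !subSS subn0.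
  by rewrite ifN; [apply: Zk|]; lia.
Qed.

Lemma eliminated_step4 {n s} : (4 <= n)%N -> eliminated (n - 2) (n - 2) (n - 2) s ->
  exists2 s', step4 n a c d e y s = Some s' & eliminated (n - 1) (n - 2) n s'.
Proof.
case: n => [|[|[|n]]] // _.
rewrite !subSS !subn0 => s_elim; rewrite /step4 !subSS !subn0 !obind_pdiv_pivot.
eexists; [reflexivity | apply: eliminated_set_last];
  by rewrite /raw_pivot /gamma_of ?subSS ?subn0.
Qed.

End Elimination.

Arguments gamma_of {K} c e s i.
Arguments raw_pivot {K} c d e s i.
Arguments eliminated {K} a b c d e y ka kb kz s.

(** * Back substitution *)

(** Indices decrease, so the cells [i.+1] and [i.+2] read at iteration [i] are already final; the
    recurrence can be stated on the final [x_] alone. *)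
Lemma step5_loop {K : fieldType} m (s : store K) :
  let s' := foldl (@step5_body K) s (rev (iota 1 m)) in
  [/\ alpha_ s' = alpha_ s, beta_ s' = beta_ s, z_ s' = z_ s,
    forall i, (m < i)%N -> x_ s' i = x_ s i
  & forall i, (0 < i <= m)%N ->
      x_ s' i = z_ s i - alpha_ s i * x_ s' i.+1 - beta_ s i * x_ s' i.+2].
Proof.
elim: m s => [|m IH] s; first by split=> // i; lia.
rewrite -[m.+1]addn1 iotaD rev_cat /= add1n.
have bodyE i : x_ (step5_body s m.+1) i = if i == m.+1
    then z_ s m.+1 - alpha_ s m.+1 * x_ s m.+2 - beta_ s m.+1 * x_ s m.+3
    else x_ s i by rewrite /step5_body addn1 addn2.
have [-> -> -> xgt xle] := IH (step5_body s m.+1).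
split=> // i => [mi|ik].
  by rewrite xgt ?bodyE ?ifN //; lia.
case: (i =P m.+1) => [->|ne]; last by apply: xle; lia.
do 3 (rewrite xgt; last lia).
by rewrite !bodyE eqxx !ifN //; lia.
Qed.

Lemma x_step5 {K : fieldType} {n} {s : store K} : (2 <= n)%N ->
  let xs := x_ (step5 n s) in
  [/\ xs n = z_ s n, xs (n - 1)%N = z_ s (n - 1) - alpha_ s (n - 1) * xs n
  & forall i, (0 < i <= n - 2)%N ->
      xs i = z_ s i - alpha_ s i * xs i.+1 - beta_ s i * xs i.+2].
Proof.
move=> n_ge2; rewrite /step5.
set s1 := set_x n _ s; set s2 := set_x (n - 1) _ s1.
have s2n : x_ s2 n = x_ s1 n by rewrite [LHS]/= ifN //; lia.
have s2n1 : x_ s2 (n - 1) = z_ s (n - 1) - alpha_ s (n - 1) * x_ s1 n.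
  by rewrite [LHS]/= eqxx.
have s1n : x_ s1 n = z_ s n by rewrite [LHS]/= eqxx.
have [_ _ _ xgt xle] := step5_loop (n - 2) s2.
have -> := xgt n; last lia.
have -> := xgt (n - 1)%N; last lia.
by rewrite s2n s2n1 s1n; split.
Qed.

(** The zero extension of the solution gives all rows the same form: at [i = n - 1] and [i = n], the
    cells that step (4) leaves unset are multiplied by values beyond [n], which are 0. *)
Lemma back_substitution {K : fieldType} {n} {s : store K} : (2 <= n)%N ->
  let X i := if (0 < i <= n)%N then x_ (step5 n s) i else 0 in
  forall i, (0 < i <= n)%N ->
    X i + (alpha_ s i * X i.+1 + beta_ s i * X i.+2) = z_ s i.
Proof.
move=> n_ge2; have [] := x_step5 (s := s) n_ge2.
move: (x_ (step5 n s)) => x xn xn1 xi X i i_in.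
have XE k : (0 < k <= n)%N -> X k = x k by rewrite /X => ->.
have X0 k : (n < k)%N -> X k = 0 by move=> nk; rewrite /X ifN //; lia.
rewrite (XE i i_in); move: X XE X0 => X XE X0.
case: (leqP i (n - 2)) => hi.
  rewrite (XE i.+1); last lia.
  rewrite (XE i.+2); last lia.
  rewrite xi; last lia.
  by rewrite -[_ - _ - _]addrA -opprD subrK.
case: (i =P n) => [->|ne].
  by rewrite (X0 n.+1) // (X0 n.+2) // xn !mulr0 !addr0.
have -> : i = (n - 1)%N by lia.
have -> : (n - 1).+1 = n by lia.
rewrite (X0 n.+1) // (XE n) ?xn1; last lia.
by rewrite mulr0 addr0 subrK.
Qed.

(** * The perturbed linear system solved by the algorithm *)

(** One row of [L (U x) = L z]: with [e, g, mu] the row of [L], add [mu], [g] and [e] times the last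
    three hypotheses. The equations for [al0] and [be0] are assumed only after multiplication by
    [u1] and [u2], which covers unset cells facing a zero. *)
Lemma elimination_identity {A : comNzRingType}
    (a b c d e y g mu delta al0 al1 al2 be0 be1 be2 z0 z1 z2 x0 x1 x2 u1 u2 : A) :
  g = c - al2 * e -> mu = d - be2 * e - al1 * g + delta ->
  mu * al0 * u1 = (a - be1 * g) * u1 -> mu * be0 * u2 = b * u2 ->
  mu * z0 = y - z2 * e - z1 * g ->
  x0 + (al0 * u1 + be0 * u2) = z0 -> x1 + (al1 * x0 + be1 * u1) = z1 ->
  x2 + (al2 * x1 + be2 * x0) = z2 ->
  e * x2 + c * x1 + (d + delta) * x0 + a * u1 + b * u2 = y.
Proof.
move=> gE muE EA EB EZ E0 E1 E2.
have -> : a * u1 = mu * al0 * u1 + be1 * g * u1 by rewrite EA; ring.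
have -> : y = mu * z0 + z2 * e + z1 * g by rewrite EZ; ring.
rewrite -EB -E0 -E1 -E2 muE gE; ring.
Qed.

Lemma eliminated_row {K : fieldType} {n : nat} {a b c d e y : nat -> ratfun K}
    {s : store K} {X : nat -> ratfun K} :
  eliminated a b c d e y (n - 1) (n - 2) n s ->
  X 0 = 0 -> (forall j, (n < j)%N -> X j = 0) ->
  (forall i, (0 < i <= n)%N ->
    X i + (alpha_ s i * X i.+1 + beta_ s i * X i.+2) = z_ s i) ->
  forall i, (i < n)%N ->
  e i.+1 * X i.-1 + c i.+1 * X i
  + (d i.+1 + rfindet K *+ (raw_pivot c d e s i.+1 == 0)) * X i.+1
  + a i.+1 * X i.+2 + b i.+1 * X i.+3 = y i.+1.
Proof.
move=> [A0 B0 Z0 As Bs Zs] X0 Xn Xs i i_lt.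
have H0 := Xs i.+1 i_lt.
(* At index 0 the back-substitution equation reads [0 = 0], so the first two rows need no separate
   treatment. *)
have H1 : X i + (alpha_ s i * X i.+1 + beta_ s i * X i.+2) = z_ s i.
  case: i i_lt {H0} => [|i] i_lt; last by apply: Xs; lia.
  by rewrite X0 A0 B0 Z0 !mul0r !addr0.
have H2 : X i.-1 + (alpha_ s i.-1 * X i + beta_ s i.-1 * X i.+1) = z_ s i.-1.
  case: i i_lt {H0 H1} => [|[|i]] i_lt; last by apply: Xs; lia.
    by rewrite X0 A0 B0 Z0 !mul0r !addr0.
  by rewrite X0 A0 B0 Z0 !mul0r !addr0.
set mu := pivot (raw_pivot c d e s i.+1).
have mu0 : mu != 0 by exact: pivot_neq0.
set g := gamma_of c e s i.+1.
have gE : g = c i.+1 - alpha_ s i.-1 * e i.+1 by rewrite /g /gamma_of subSS subn1.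
have muE : mu = d i.+1 - beta_ s i.-1 * e i.+1 - alpha_ s i * g
    + rfindet K *+ (raw_pivot c d e s i.+1 == 0).
  by rewrite /mu pivotE {1}/raw_pivot subSS !subn1.
(* In the last row [alpha_n] satisfies no recurrence, but its factor [X n.+1] is 0. *)
have EA : mu * alpha_ s i.+1 * X i.+2 = (a i.+1 - beta_ s i * g) * X i.+2.
  case: (ltnP i.+1 n) => hi; last by rewrite Xn // !mulr0.
  have -> := As i.+1; last lia.
  by rewrite subn1 -/mu -/g [mu * _]mulrC divfK.
have EB : mu * beta_ s i.+1 * X i.+3 = b i.+1 * X i.+3.
  case: (ltnP i.+2 n) => hi; last by rewrite Xn // !mulr0.
  have -> := Bs i.+1; last lia.
  by rewrite -/mu [mu * _]mulrC divfK.
have EZ : mu * z_ s i.+1 = y i.+1 - z_ s i.-1 * e i.+1 - z_ s i * g.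
  have -> := Zs i.+1; last lia.
  by rewrite subSS !subn1 -/mu -/g mulrC divfK.
exact: elimination_identity gE muE EA EB EZ H0 H1 H2.
Qed.

Lemma eliminated_solves {K : fieldType} {n : nat} {a b c d e y : nat -> ratfun K}
    {s : store K} :
  (2 <= n)%N -> eliminated a b c d e y (n - 1) (n - 2) n s ->
  pentadiag_mx n a b c (fun i => d i + rfindet K *+ (raw_pivot c d e s i == 0)) e
    *m \col_(i < n) x_ (step5 n s) i.+1 = \col_(i < n) y i.+1.
Proof.
move=> n_ge2 s_elim; apply/colP => i; rewrite [LHS]mxE [RHS]mxE.
have := back_substitution (s := s) n_ge2.
set X := fun j => _ => XE.
have XS (j : 'I_n) : x_ (step5 n s) j.+1 = X j.+1 by rewrite /X ltn_ord.
under eq_bigr => j _ do rewrite [(\col_ _ _) _ _]mxE XS.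
have X0 : X 0 = 0 by [].
have Xn j : (n < j)%N -> X j = 0 by move=> hj; rewrite /X ifN //; lia.
rewrite mul_pentadiag_row //.
exact: eliminated_row s_elim X0 Xn XE i (ltn_ord i).
Qed.

(** * The complete run of the algorithm *)

Lemma obind_some {T U : Type} (f : T -> option U) (x : T) : obind f (Some x) = f x.
Proof. by []. Qed.

Lemma sptrans_ratfun_eliminated {K : fieldType} {n : nat}
    (a b c d e y : nat -> ratfun K) : (4 <= n)%N ->
  exists2 s, sptrans_ratfun n a b c d e y = Some (\col_(i < n) x_ (step5 n s) i.+1)
    & eliminated a b c d e y (n - 1) (n - 2) n s.
Proof.
move=> n_ge4.
have s0_elim := @eliminated_init K a b c d e y.
have [s1 E1 s1_elim] := eliminated_step3_body s0_elim.
have [s2 E2 s2_elim] := eliminated_step3_body s1_elim.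
have [s3 E3 s3_elim] := eliminated_step3 s2_elim n_ge4.
have [s4 E4 s4_elim] := eliminated_step4 n_ge4 s3_elim.
exists s4 => //; rewrite /sptrans_ratfun (step1_step3_body s0_elim) E1 obind_some.
rewrite (step2_step3_body s1_elim) E2 obind_some E3 obind_some E4.
by rewrite obind_some.
Qed.

(** * Substitution of 0 for the indeterminate *)

(** The perturbed matrix comes from one over [{poly K}], where determinant and adjugate are
    polynomial and evaluation at 0 is a ring morphism. *)
Lemma pentadiag_rfconst {K : fieldType} n (a b c d e : nat -> K) (D : nat -> bool) :
  pentadiag_mx n (@rfconst K \o a) (@rfconst K \o b) (@rfconst K \o c)
    (fun i => (@rfconst K \o d) i + rfindet K *+ D i) (@rfconst K \o e) =
  map_mx (@FracField.tofrac {poly K})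
    (map_mx polyC (pentadiag_mx n a b c d e) + diag_mx (\row_(i < n) ('X *+ D i.+1))).
Proof.
apply/matrixP => i j; rewrite !mxE /=.
case: (eqVneq i j) => [->|ne]; first by rewrite eqxx mulr1n rmorphD rmorphMn.
have jNi : (nat_of_ord j == i) = false by rewrite eq_sym; exact: negPf ne.
rewrite jNi mulr0n addr0.
by do 4 (case: ifP => // _); rewrite /= ?polyC0 ?rmorph0.
Qed.

Theorem mainTheorem3 (R : realType) (K : fieldType)
    (hK : K = (R : fieldType) \/ K = (R[i] : fieldType))
    (n : nat) (hn : (4 <= n)%N) (a b c d e y : nat -> K)
    (hdet : \det (pentadiag_mx n a b c d e) != 0) :
  exists x : 'cV[ratfun K]_n,
    [/\ sptransI n a b c d e y = Some x,
        forall i : 'I_n, ~~ has_pole (x i ord0) 0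
      & forall V : 'cV[K]_n,
          pentadiag_mx n a b c d e *m V = \col_(i < n) y i.+1 <->
          V = \col_(i < n) rfeval 0 (x i ord0)].
Proof.
have [s sE s_elim] := sptrans_ratfun_eliminated (@rfconst K \o a) (@rfconst K \o b)
  (@rfconst K \o c) (@rfconst K \o d) (@rfconst K \o e) (@rfconst K \o y) hn.
have := eliminated_solves (ltnW (ltnW hn)) s_elim.
move: (\col_(i < n) _) sE => x xE.
rewrite pentadiag_rfconst.
set P := pentadiag_mx n a b c d e in hdet *; set Y := \col_(i < n) y i.+1.
set Q := _ + _; move=> Qx.
have Q0 : map_mx (horner_eval 0) Q = P.
  apply/matrixP => i j; rewrite [LHS]mxE [Q i j]mxE [map_mx _ _ i j]mxE /horner_eval.
  rewrite [diag_mx _ i j]mxE [(\row__ _) _ _]mxE hornerD hornerC !hornerMn.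
  by rewrite hornerX !mul0rn addr0.
have detQ0 : (\det Q).[0] = \det P by rewrite -Q0 det_map_mx.
(* The adjugate commutes with ring morphisms, here with evaluation at 0. *)
have adjQ0 : map_mx (horner_eval 0) (\adj Q *m map_mx polyC Y) = \adj P *m Y.
  rewrite map_mxM map_mx_adj Q0; congr (_ *m _).
  by apply/colP => i; rewrite [LHS]mxE [map_mx _ _ i _]mxE; exact: hornerC.
have cramer i : FracField.tofrac (\det Q) * x i ord0
    = FracField.tofrac ((\adj Q *m map_mx polyC Y) i ord0).
  have /matrixP/(_ i ord0) := congr1 (mulmx (map_mx (@FracField.tofrac _) (\adj Q))) Qx.
  rewrite mulmxA -map_mxM mul_adj_mx map_scalar_mx mul_scalar_mx mxE => ->.
  have -> : \col_(i < n) (@rfconst K \o y) i.+1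
      = map_mx (@FracField.tofrac _) (map_mx polyC Y).
    by apply/colP => k; rewrite !mxE.
  by rewrite -map_mxM mxE.
have regular i := rfeval_quotient (eq_ind_r (fun t => t != 0) hdet detQ0) (cramer i).
exists x; split=> // [i|V]; first by have [] := regular i.
(* Evaluating [cramer] at 0 turns the output into Cramer's formula for [P]; both implications then
   follow from the adjugate identities. *)
have -> : \col_(i < n) rfeval 0 (x i ord0) = (\det P)^-1 *: (\adj P *m Y).
  apply/colP => i; have [_] := regular i; rewrite detQ0 => rE.
  by rewrite -adjQ0 [LHS]mxE mxE [in RHS]mxE /horner_eval -rE mulKf.
split=> [<-|->].
  by rewrite mulmxA mul_adj_mx mul_scalar_mx scalerA mulVf ?scale1r.
by rewrite -scalemxAr mulmxA mul_mx_adj mul_scalar_mx scalerA mulVf ?scale1r.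
Qed.
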